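(* Let $\rho:H\to GL(V)$ be a representation of a compact Lie group $H$ with Lie algebra $\mathfrak h$, and let $X,Y:V\to V$ be two $H$-invariant vector fields that are isomorphic, i.e. $X=Y+\psi_V$ for some $H$-equivariant map $\psi:V\to\mathfrak h$. Suppose $X(0)=0$. Then $Y(0)=0$ and $$DX(0)=DY(0)+\delta\rho(\psi(0)),$$ where $\delta\rho:\mathfrak h\to\mathfrak{gl}(V)$ is the representation of the Lie algebra $\mathfrak h$ corresponding to $\rho$.
   Context: $V$ is a finite-dimensional real vector space and all maps are smooth. $H$-equivariance of $\psi$ means $\psi(\rho(h)v)=\mathrm{Ad}(h)\psi(v)$ for $h\in H$, $v\in V$. The vector field $\psi_V$ is $\psi_V(v)=\frac{d}{dt}\big|_{t=0}\rho(\exp(t\psi(v)))v$. $DX(0):V\to V$ is the derivative of $X:V\to V$ at $0$. *)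

(* Defs.v *)
From HB Require Import structures.
From mathcomp Require Import all_boot all_order all_algebra.
From mathcomp Require Import all_classical all_reals all_analysis.

Set Implicit Arguments.
Unset Strict Implicit.
Unset Printing Implicit Defensive.

Import Order.TTheory GRing.Theory Num.Theory.
Import numFieldNormedType.Exports.

Local Open Scope classical_set_scope.
Local Open Scope ring_scope.

(* Finite-dimensional real vector spaces. The norm only serves to provide the
   topology, which in finite dimension does not depend on it. *)
#[short(type="normedVectType")]
HB.structure Definition NormedVector (R : realType) :=
  {V of NormedModule R V & Vector R V}.

#[short(type="topGroupType")]
HB.structure Definition TopologicalAndGroup := {H of Topological H & Group H}.

Section Smooth.
Variables (R : realType) (E F : normedModType R).

(* For U open and E finite-dimensional this is the usual class C^k: f is C^k.+1
   iff it is differentiable with C^k directional derivatives. *)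
Fixpoint Ck (k : nat) (f : E -> F) (U : set E) : Prop :=
  if k is k'.+1 then
    (forall x, U x -> differentiable f x) /\ (forall v, Ck k' ('D_v f) U)
  else forall x, U x -> {for x, continuous f}.

Definition smooth_on (f : E -> F) (U : set E) : Prop := forall k, Ck k f U.

Definition smooth (f : E -> F) : Prop := smooth_on f setT.

End Smooth.

(* Charts are given by total functions; chart_fun is only meaningful on
   chart_dom, and chart_inv on chart_cod. *)
Record chart (R : realType) (E : normedModType R) (M : topologicalType) :=
  Chart {
    chart_dom : set M;
    chart_fun : M -> E;
    chart_inv : E -> M }.

Definition chart_cod (R : realType) (E : normedModType R)
    (M : topologicalType) (c : chart E M) : set E :=
  chart_fun c @` chart_dom c.

Definition is_chart (R : realType) (E : normedModType R)
    (M : topologicalType) (c : chart E M) : Prop :=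
  [/\ open (chart_dom c), open (chart_cod c),
      forall x, chart_dom c x -> chart_inv c (chart_fun c x) = x,
      forall x, chart_dom c x -> {for x, continuous (chart_fun c)} &
      forall y, chart_cod c y -> {for y, continuous (chart_inv c)}].

(* An atlas together with a preferred chart around each point p. The preferred
   chart identifies the tangent space at p with the model space E. *)
Record charted (R : realType) (E : normedModType R) (M : topologicalType) :=
  Charted {
    atlas : set (chart E M);
    chart_at : M -> chart E M }.

Definition is_manifold (R : realType) (E : normedModType R)
    (M : topologicalType) (A : charted E M) : Prop :=
  [/\ hausdorff_space M /\ @second_countable M,
      forall c, atlas A c -> is_chart c,
      forall p, atlas A (chart_at A p) /\ chart_dom (chart_at A p) p &
      forall c d, atlas A c -> atlas A d ->
        smooth_on (chart_fun d \o chart_inv c)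
          (chart_fun c @` (chart_dom c `&` chart_dom d))].

Definition vector_chart (R : realType) (E : normedModType R) : chart E E :=
  Chart setT id id.

Definition vector_charted (R : realType) (E : normedModType R) : charted E E :=
  Charted [set vector_chart E] (fun=> vector_chart E).

Definition prod_chart (R : realType) (E F : normedModType R)
    (M N : topologicalType) (c : chart E M) (d : chart F N) :
    chart (E * F)%type (M * N)%type :=
  Chart (chart_dom c `*` chart_dom d)
    (fun p => (chart_fun c p.1, chart_fun d p.2))
    (fun x => (chart_inv c x.1, chart_inv d x.2)).

Definition prod_charted (R : realType) (E F : normedModType R)
    (M N : topologicalType) (A : charted E M) (B : charted F N) :
    charted (E * F)%type (M * N)%type :=
  Charted
    [set cd | exists c d, [/\ atlas A c, atlas B d & cd = prod_chart c d]]
    (fun p => prod_chart (chart_at A p.1) (chart_at B p.2)).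

Definition smooth_map (R : realType) (E F : normedModType R)
    (M N : topologicalType) (A : charted E M) (B : charted F N)
    (f : M -> N) : Prop :=
  continuous f /\
  forall c d, atlas A c -> atlas B d ->
    smooth_on (chart_fun d \o f \o chart_inv c)
      (chart_fun c @` (chart_dom c `&` f @^-1` chart_dom d)).

(* The tangent map T_p M -> T_(f p) N, both tangent spaces being identified with
   the model spaces through the preferred charts at p and at f p. *)
Definition tangent_map (R : realType) (E F : normedModType R)
    (M N : topologicalType) (A : charted E M) (B : charted F N)
    (f : M -> N) (p : M) : E -> F :=
  'd (chart_fun (chart_at B (f p)) \o f \o chart_inv (chart_at A p))
     (chart_fun (chart_at A p) p).

Section LieGroup.
(* The model space is the Lie algebra T_1 H. *)
Variables (R : realType) (h : normedVectType R) (H : topGroupType).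
Variable A : charted h H.

Definition is_lie_group : Prop :=
  [/\ is_manifold A,
      smooth_map (prod_charted A A) A (fun p => (p.1 * p.2)%g) &
      smooth_map A A (fun g => (g^-1)%g)].

Definition is_compact_lie_group : Prop := is_lie_group /\ compact [set: H].

(* The exponential map is the unique map such that, for every xi in the Lie
   algebra, t |-> exp (t xi) is the one-parameter subgroup with velocity xi
   at t = 0. *)
Definition is_lie_exp (exp : h -> H) : Prop :=
  forall xi : h,
    [/\ forall s t : R, exp ((s + t) *: xi) = (exp (s *: xi) * exp (t *: xi))%g,
        smooth_map (vector_charted R^o) A (fun t : R^o => exp (t *: xi)) &
        tangent_map (vector_charted R^o) A (fun t : R^o => exp (t *: xi)) 0 1
          = xi].

Definition Ad (g : H) : h -> h :=
  tangent_map A A (fun x => (g * x * g^-1)%g) 1%g.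

Variable V : normedVectType R.

(* The values of rho are automatically invertible. Since V is
   finite-dimensional, rho is smooth as a map into the vector space 'End(V) iff
   all the maps g |-> rho g v are. *)
Definition is_representation (rho : H -> 'End(V)) : Prop :=
  [/\ rho 1%g = \1%VF,
      forall g1 g2, rho (g1 * g2)%g = (rho g1 \o rho g2)%VF &
      forall v : V, smooth_map A (vector_charted V) (fun g => rho g v)].

(* The tangent map of rho at 1, evaluated at v; evaluation at v is linear, hence
   commutes with differentiation. *)
Definition delta_rho (rho : H -> 'End(V)) (xi : h) (v : V) : V :=
  tangent_map A (vector_charted V) (fun g => rho g v) 1%g xi.

Definition invariant_field (rho : H -> 'End(V)) (X : V -> V) : Prop :=
  forall g v, X (rho g v) = rho g (X v).

Definition equivariant (rho : H -> 'End(V)) (psi : V -> h) : Prop :=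
  forall g v, psi (rho g v) = Ad g (psi v).

Definition induced_field (exp : h -> H) (rho : H -> 'End(V)) (psi : V -> h)
    (v : V) : V :=
  derive1 (fun t : R => rho (exp (t *: psi v)) v) 0.

End LieGroup.

(* Main.v *)
(** By the chain rule the induced vector field of psi at v is
    delta_rho (psi v) v, which is linear in each of the two arguments; hence it
    vanishes at 0, and its difference quotients at 0 in the direction w are
    delta_rho (psi (t w)) w, which tend to delta_rho (psi 0) w since psi is
    continuous. *)
Require Import Defs.
From mathcomp Require Import all_boot all_order all_algebra.
From mathcomp Require Import all_classical all_reals all_analysis.
Import GRing.Theory numFieldNormedType.Exports.

Set Implicit Arguments.
Unset Strict Implicit.
Unset Printing Implicit Defensive.

Local Open Scope ring_scope.

Lemma smooth_differentiable (R : realType) (E F : normedModType R)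
    (f : E -> F) (U : set E) (x : E) :
  smooth_on f U -> U x -> differentiable f x.
Proof. by move=> /(_ 1%N)[+ _]; apply. Qed.

(** The one-parameter law at [s = t = 0] makes [exp 0] idempotent, and cancellation in the group
    leaves [1]. *)
Lemma lie_exp0 (R : realType) (h : normedVectType R) (H : topGroupType)
    (A : charted h H) (exp : h -> H) :
  is_lie_exp A exp -> exp 0 = 1%g.
Proof.
move=> /(_ 0)[/(_ 0 0) + _ _]; rewrite addr0 scale0r => e.
by apply: (mulgI (exp 0)); rewrite mulg1 -e.
Qed.

Section Representation.
Variables (R : realType) (h V : normedVectType R) (H : topGroupType).
Variables (A : charted h H) (rho : H -> 'End(V)).
Hypotheses (HA : is_manifold A) (Hrho : is_representation A rho).

Let c := chart_at A 1%g.

Lemma atlas_chart_at (g : H) : atlas A (chart_at A g).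
Proof. by case: HA => _ _ /(_ g)[]. Qed.

Lemma chart_at_dom (g : H) : chart_dom (chart_at A g) g.
Proof. by case: HA => _ _ /(_ g)[]. Qed.

Lemma differentiable_rho_chart (v : V) :
  differentiable (fun x => rho (chart_inv c x) v) (chart_fun c 1%g).
Proof.
case: Hrho => _ _ /(_ v)[_ /(_ _ (vector_chart V) (atlas_chart_at 1%g) erefl)].
move=> /smooth_differentiable; apply.
by exists 1%g => //; split=> //; exact: chart_at_dom.
Qed.

(** Holds by computation, since the preferred chart of [V] is the identity. *)
Lemma delta_rhoE (xi : h) (v : V) :
  delta_rho A rho xi v =
  'd (fun x => rho (chart_inv c x) v) (chart_fun c 1%g) xi.
Proof. by []. Qed.

Lemma delta_rho_continuous (v : V) :
  continuous (fun xi => delta_rho A rho xi v).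
Proof. exact: diff_continuous (differentiable_rho_chart v). Qed.

(** Each [rho g] is linear, so scaling [v] scales the function being differentiated. *)
Lemma delta_rhoZ (xi : h) (a : R) (v : V) :
  delta_rho A rho xi (a *: v) = a *: delta_rho A rho xi v.
Proof.
rewrite !delta_rhoE -[RHS]/((a \*: 'd _ _) xi).
rewrite -(diffZ a (differentiable_rho_chart v)).
by congr ('d _ _ xi); apply/funext => x; rewrite linearZ.
Qed.

Lemma delta_rho0 (xi : h) : delta_rho A rho xi 0 = 0.
Proof. by have := delta_rhoZ xi 0 0; rewrite !scale0r. Qed.

(** Chain rule in the chart [c] at [1]: near [t = 0] the curve is the local expression of [rho]
    applied to the coordinates of [exp (t *: psi v)], whose velocity at [0] is [psi v]. *)
Lemma induced_fieldE (exp : h -> H) (psi : V -> h) (v : V) :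
  is_lie_exp A exp ->
  induced_field exp rho psi v = delta_rho A rho (psi v) v.
Proof.
move=> Hexp; have exp0 := lie_exp0 Hexp.
have [_ [gam_cont gam_smooth] +] := Hexp (psi v).
rewrite /tangent_map /= scale0r exp0 -/c => gam'.
set gam := fun t : R^o => exp (t *: psi v).
have gam0 : gam 0 = 1%g by rewrite /gam scale0r.
have dgam : differentiable (chart_fun c \o gam : R^o -> h) 0.
  have := gam_smooth _ _ (erefl (vector_chart R^o)) (atlas_chart_at 1%g).
  move=> /smooth_differentiable; apply.
  by exists 0 => //; split=> //=; rewrite scale0r exp0; exact: chart_at_dom.
have drho : differentiable (fun x => rho (chart_inv c x) v)
    ((chart_fun c \o gam) 0).
  by rewrite /= gam0; exact: differentiable_rho_chart.
have [_ /(_ _ (atlas_chart_at 1%g))[c_open _ cK _ _] _ _] := HA.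
(* Inserting [chart_inv c \o chart_fun c] is harmless only inside the chart domain; this suffices
   because a derivative depends only on the germ at [0]. *)
have near_c : \forall t \near (0 : R^o), chart_dom c (gam t).
  apply: gam_cont; rewrite -/(gam 0) gam0.
  by apply: open_nbhs_nbhs; split=> //; exact: chart_at_dom.
rewrite /induced_field derive1E.
rewrite (@near_eq_derive _ R^o _ _
  ((fun x => rho (chart_inv c x) v) \o (chart_fun c \o gam))); last first.
  by apply: filterS near_c => t ct /=; rewrite cK.
rewrite deriveE; last exact: differentiable_comp.
by rewrite diff_comp //= gam' gam0.
Qed.

End Representation.

Theorem theorem1p9 (R : realType) (H : topGroupType) (h : normedVectType R)
    (A : charted h H) (exp : h -> H) (V : normedVectType R)
    (rho : H -> 'End(V)) (X Y : V -> V) (psi : V -> h)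
    (HH : is_compact_lie_group A) (Hexp : is_lie_exp A exp)
    (Hrho : is_representation A rho)
    (X_smooth : smooth X) (Y_smooth : smooth Y)
    (X_inv : invariant_field rho X) (Y_inv : invariant_field rho Y)
    (psi_smooth : smooth psi) (psi_equiv : equivariant A rho psi)
    (XY : forall v : V, X v = Y v + induced_field exp rho psi v)
    (X0 : X 0 = 0) :
  Y 0 = 0 /\
  (forall w : V, 'd X (0 : V) w = 'd Y (0 : V) w + delta_rho A rho (psi 0) w).
Proof.
have [[HA _ _] _] := HH.
have XE v : X v = Y v + delta_rho A rho (psi v) v.
  by rewrite XY (induced_fieldE HA Hrho _ _ Hexp).
have Y0 : Y 0 = 0.
  by have := XE 0; rewrite X0 (delta_rho0 HA Hrho) addr0.
split=> // w.
have dX : differentiable X 0 by exact: smooth_differentiable X_smooth _.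
have dY : differentiable Y 0 by exact: smooth_differentiable Y_smooth _.
rewrite -!deriveE //.
(* By uniqueness of limits, it suffices that the difference quotients of [X] at [0] along [w]
   converge to the right-hand side. *)
apply: cvg_lim; first exact: norm_hausdorff.
have quotE : {near ((0 : R)^')%classic, (fun t : R =>
    t^-1 *: ((Y \o shift 0) (t *: w) - Y 0) + delta_rho A rho (psi (t *: w)) w)
    =1 (fun t => t^-1 *: ((X \o shift 0) (t *: w) - X 0))}.
  near=> t; have t_neq0 : t != 0 by near: t; exact: nbhs_dnbhs_neq.
  (* Homogeneity in the vector argument pulls a factor [t] out of [delta_rho], which cancels
     [t^-1]. *)
  rewrite /= !addr0 X0 Y0 !subr0 XE (delta_rhoZ HA Hrho).
  by rewrite scalerDr scalerA mulVf // scale1r.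
apply: cvg_trans; first exact: (near_eq_cvg quotE).
apply: cvgD; first exact: diff_derivable.
have psi_cont : {for 0, continuous psi} by exact: psi_smooth 0%N _ _.
(* The remaining term is a composite of continuous maps evaluated along [t *: w], which tends to
   [0]. *)
apply: (@continuous_cvg _ _ _ _ _ _ (fun xi => delta_rho A rho xi w)).
  exact: (delta_rho_continuous HA Hrho).
apply: (@continuous_cvg _ _ _ _ _ _ psi) => //.
rewrite -(scale0r w); apply: cvgZr_tmp.
exact: nbhs_dnbhs.
Unshelve. all: by end_near.
Qed.
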